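(* Let $(X,d)$ be a metric space, let $g:X\to\mathbb{R}$ be bounded above, let $\theta>0$, and for $x\in X$ let $$S(x)=\{y\in X:\ g(y)-g(x)\ge\theta\,d(x,y)\},\qquad s(x)=\sup\{g(y):\ y\in S(x)\}.$$ Let $W$ be a set-valued map assigning to each $x\in X$ a set $W(x)\subset X$ with $x\in W(x)$ and $W(x)\subset S(x)$. Let $0<\underline{\sigma}<1$, and let $(x_n)_{n\in\mathbb{N}}$ be a sequence in $X$ such that for all $n\in\mathbb{N}$ $$x_{n+1}\in W(x_n)\subset S(x_n)\quad\text{and}\quad g(x_{n+1})-g(x_n)\ \ge\ \underline{\sigma}\,\bigl[s(x_n)-g(x_n)\bigr]\ \ge\ 0 .$$ Then the radius of the worthwhile-to-move set converges to zero: $\rho(W(x_n))\to 0$ as $n\to+\infty$.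
   Context: For a set $A(x)\subset X$ attached to a point $x$ (here $A=W$ or $A=S$), its radius is $\rho(A(x))=\sup_{y\in A(x)}d(x,y)$; thus $\rho(W(x_n))=\sup_{y\in W(x_n)}d(x_n,y)$. $W(x)$ is the ''worthwhile-to-move'' set at $x$, and $S(x)$ is the enclosing set (''the agent has enclosed his worthwhile-to-move process'' means $W(x)\subset S(x)$ for all $x$). *)

(* Defs.v *)
From HB Require Import structures.
From mathcomp Require Import all_boot all_order all_algebra.
From mathcomp Require Import all_classical all_reals all_analysis.

Set Implicit Arguments.
Unset Strict Implicit.
Unset Printing Implicit Defensive.

Import Order.TTheory GRing.Theory Num.Theory.

Local Open Scope classical_set_scope.
Local Open Scope ring_scope.

Definition enclosing_set (R : realType) (X : metricType R) (g : X -> R)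
    (theta : R) (x : X) : set X :=
  [set y | g y - g x >= theta * mdist x y].

(* [sup] returns 0 outside [has_sup]. That case does not arise when [g] is
   bounded above, as [x] always belongs to [enclosing_set g theta x]. *)
Definition enclosing_sup (R : realType) (X : metricType R) (g : X -> R)
    (theta : R) (x : X) : R :=
  sup (g @` enclosing_set g theta x).

(* Extended-real valued, so that an unbounded [A] has radius [+oo]. *)
Definition set_radius (R : realType) (X : metricType R) (x : X) (A : set X) :
    \bar R :=
  ereal_sup [set (mdist x y)%:E | y in A].

(* Main.v *)
Require Import Defs.
From HB Require Import structures.
From mathcomp Require Import all_boot all_order all_algebra.
From mathcomp Require Import all_classical all_reals all_analysis.

(** The slack [enclosing_sup g theta z - g z], divided by [theta], bounds the
    radius of every subset of the enclosing set at [z], because there each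
    unit of distance comes with a gain of at least [theta] in [g]
    ([set_radius_le_slack]). Along
    the sequence, each step gains at least the fraction [sigma] of that slack,
    so the radius is at most the gain [g (x n.+1) - g (x n)] divided by
    [sigma * theta]. The values [g (x n)] are nondecreasing and bounded above,
    hence convergent, so the gains tend to zero ([cvg_increment0]) and the
    radius is squeezed between zero and a multiple of them. *)

Set Implicit Arguments.
Unset Strict Implicit.
Unset Printing Implicit Defensive.

Import Order.TTheory GRing.Theory Num.Theory.

Local Open Scope classical_set_scope.
Local Open Scope ring_scope.

(** The point [z] itself contributes the distance 0; the supremum of the empty
    set would be [-oo]. *)
Lemma set_radius_ge0 (R : realType) (X : metricType R) (z : X) (A : set X) :
  A z -> (0 <= set_radius z A)%E.
Proof.
move=> Az; apply: ereal_sup_ubound.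
by exists z => //=; rewrite mdistxx.
Qed.

(** For [y] in [A], [theta * mdist z y <= g y - g z], and [g y] is one of the
    values whose supremum is [enclosing_sup g theta z]; the bound on [g] makes
    that supremum a genuine one. *)
Lemma set_radius_le_slack (R : realType) (X : metricType R) (g : X -> R)
    (theta : R) (z : X) (A : set X) :
  has_ubound (range g) -> 0 < theta -> A `<=` enclosing_set g theta z ->
  (set_radius z A <= ((enclosing_sup g theta z - g z) / theta)%:E)%E.
Proof.
move=> [M gM] theta_gt0 AS; apply: ge_ereal_sup => _ [y Ay <-].
rewrite lee_fin ler_pdivlMr// mulrC.
apply: le_trans (AS _ Ay) _; rewrite lerD2r.
apply: ub_le_sup; last by exists y => //; exact: AS.
by exists M => _ [w _ <-]; apply: gM; exists w.
Qed.

Lemma cvg_increment0 (R : realType) (u : nat -> R) :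
  nondecreasing_seq u -> has_ubound (range u) ->
  u n.+1 - u n @[n --> \oo] --> 0.
Proof.
move=> u_nd u_ub.
have u_cvg := nondecreasing_cvgn u_nd u_ub.
rewrite -[X in _ --> X](subrr (sup (range u))).
by apply: cvgB => //; rewrite cvg_shiftS.
Qed.

Theorem mainTheorem3 (R : realType) (X : metricType R) (g : X -> R)
    (theta : R) (W : X -> set X) (sigma : R) (x : nat -> X)
    (g_bounded : has_ubound (range g))
    (theta_gt0 : 0 < theta)
    (W_refl : forall z : X, W z z)
    (W_enclosed : forall z : X, W z `<=` enclosing_set g theta z)
    (sigma_gt0 : 0 < sigma) (sigma_lt1 : sigma < 1)
    (x_worthwhile : forall n : nat,
      W (x n) (x n.+1) /\ W (x n) `<=` enclosing_set g theta (x n))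
    (x_improving : forall n : nat,
      g (x n.+1) - g (x n) >= sigma * (enclosing_sup g theta (x n) - g (x n))
      /\ sigma * (enclosing_sup g theta (x n) - g (x n)) >= 0) :
  set_radius (x n) (W (x n)) @[n --> \oo] --> 0%E.
Proof.
have x_nd : nondecreasing_seq (g \o x).
  apply/nondecreasing_seqP => n /=.
  have [gain slack_ge0] := x_improving n.
  by rewrite -subr_ge0 (le_trans slack_ge0).
have x_ub : has_ubound (range (g \o x)).
  by case: g_bounded => M gM; exists M => _ [n _ <-]; apply: gM; exists (x n).
have bound_cvg0 :
    ((g (x n.+1) - g (x n)) / (sigma * theta))%:E @[n --> \oo] --> 0%E.
  apply: cvg_EFin; first exact: nearW.
  rewrite -[X in _ --> X](mul0r (sigma * theta)^-1).
  exact: cvgMr_tmp (cvg_increment0 x_nd x_ub).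
apply: (squeeze_cvge _ (cvg_cst _) bound_cvg0).
apply: nearW => n; rewrite set_radius_ge0//=.
have slack_ge := set_radius_le_slack g_bounded theta_gt0 (W_enclosed (x n)).
apply: le_trans slack_ge _.
rewrite lee_fin invfM mulrA ler_pM2r ?invr_gt0// ler_pdivlMr// mulrC.
by case: (x_improving n).
Qed.
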